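(* Let $\mathbb{F}$ be a field, let $E$ be a $12$-dimensional symplectic vector space over $\mathbb{F}$, let $f:\wedge^{6}E\rightarrow\wedge^{4}E$ be the contraction map, and let $B$ be the $\binom{12}{4}\times\binom{12}{6}$ matrix over $\mathbb{F}$ of the system of Plücker linear relations (both defined in the context). Then the rank of $B$ and the codimension of the linear section $\mathbb{P}(\ker f)$ in $\mathbb{P}(\wedge^{6}E)$ are as follows: \begin{itemize} \item if $\operatorname{char}(\mathbb{F})=0$, then $\operatorname{rank}(B)=495$ and the codimension of $\mathbb{P}(\ker f)$ is $429$; \item if $\operatorname{char}(\mathbb{F})=2$, then $\operatorname{rank}(B)=430$ and the codimension of $\mathbb{P}(\ker f)$ is $494$; \item if $\operatorname{char}(\mathbb{F})=3$, then $\operatorname{rank}(B)=494$ and the codimension of $\mathbb{P}(\ker f)$ is $430$; \item if $\operatorname{char}(\mathbb{F})=p\ge 5$, then $\operatorname{rank}(B)=495$ and the codimension of $\mathbb{P}(\ker f)$ is $429$. \end{itemize}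
   Context: A symplectic vector space is a finite-dimensional vector space $E$ over a field $\mathbb{F}$ with a non-degenerate alternating bilinear form $\langle\,,\,\rangle$. Here $\dim E=12$. The contraction map $f:\wedge^{6}E\to\wedge^{4}E$ is the $\mathbb{F}$-linear map determined by $$f(w_1\wedge\cdots\wedge w_6)=\sum_{1\le s<t\le 6}(-1)^{s+t-1}\langle w_s,w_t\rangle\, w_1\wedge\cdots\wedge\widehat{w}_s\wedge\cdots\wedge\widehat{w}_t\wedge\cdots\wedge w_6,$$ where a hat means that the factor is omitted. $\mathbb{P}(\ker f)\subseteq\mathbb{P}(\wedge^6E)$ denotes the projectivization of $\ker f$. For positive integers $\ell\le m$, $I(\ell,m)$ denotes the set of $\ell$-tuples $\alpha=(\alpha_1,\dots,\alpha_\ell)$ of integers with $1\le\alpha_1<\cdots<\alpha_\ell\le m$, identified with the $\ell$-element subsets of $\{1,\dots,m\}$. For $\alpha\in I(4,12)$ the Plücker linear relation attached to $\alpha$ is the homogeneous linear equation $$\Pi_\alpha:\quad \sum_{i=1}^{6}c_{i,\alpha}\,X_{\alpha\cup\{i,13-i\}}=0$$ in the variables $X_\beta$, $\beta\in I(6,12)$, where $c_{i,\alpha}=1$ if $|\alpha\cup\{i,13-i\}|=6$ and $c_{i,\alpha}=0$ (the term does not appear) otherwise; variables are indexed by subsets, irrespective of the order of the indices. $B$ is the coefficient matrix over $\mathbb{F}$ of the system $\{\Pi_\alpha:\alpha\in I(4,12)\}$, with rows indexed by $I(4,12)$ and columns indexed by $I(6,12)$.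
   Formalization: The printed codimensions 429, 494, 430, 429 are really the vector space dimensions of ker f; the theorem states them as such and gives the true codimension of P(ker f), equal to rank(B): 495, 430, 494, 495. *)

(* Defs.v *)
From HB Require Import structures.
From mathcomp Require Import all_boot all_order all_algebra.

Set Implicit Arguments.
Unset Strict Implicit.
Unset Printing Implicit Defensive.

Import GRing.Theory.
Local Open Scope ring_scope.

Definition symplectic (F : fieldType) (E : vectType F) (form : {biscalar E}) :
    Prop :=
  (forall u, form u u = 0) /\
  (forall u, (forall v, form u v = 0) -> u = 0).

(* A k-tuple of vectors is a finite function w : {ffun 'I_k -> E}. *)
Definition replace_arg (F : fieldType) (E : lmodType F) (k : nat)
    (w : {ffun 'I_k -> E}) (i : 'I_k) (x : E) : {ffun 'I_k -> E} :=
  [ffun j => if j == i then x else w j].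

Definition multilinear_map (F : fieldType) (E V : lmodType F) (k : nat)
    (m : {ffun 'I_k -> E} -> V) : Prop :=
  forall (w : {ffun 'I_k -> E}) (i : 'I_k), linear (fun x : E => m (replace_arg w i x)).

Definition alternating_map (F : fieldType) (E V : lmodType F) (k : nat)
    (m : {ffun 'I_k -> E} -> V) : Prop :=
  forall (w : {ffun 'I_k -> E}) (i j : 'I_k), i != j -> w i = w j -> m w = 0.

(* W together with wedge : (w_1, ..., w_k) |-> w_1 /\ ... /\ w_k is a k-th    *)
(* exterior power of E, i.e. wedge is the universal alternating k-linear map. *)
Definition exterior_power (F : fieldType) (E W : vectType F) (k : nat)
    (wedge : {ffun 'I_k -> E} -> W) : Prop :=
  [/\ multilinear_map wedge, alternating_map wedge
    & forall (V : lmodType F) (m : {ffun 'I_k -> E} -> V),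
        multilinear_map m -> alternating_map m ->
        exists2 h : {linear W -> V},
          forall w, h (wedge w) = m w
          & forall h' : {linear W -> V},
              (forall w, h' (wedge w) = m w) -> h' =1 h].

(* For s < t, the map j |-> bump t (bump s j) is the increasing enumeration   *)
(* of the indices other than s and t.                                         *)
Definition omit2 (F : fieldType) (E : lmodType F) (k : nat)
    (w : {ffun 'I_k.+2 -> E}) (s t : 'I_k.+2) : {ffun 'I_k -> E} :=
  [ffun j : 'I_k => w (inord (bump t (bump s j)))].

(* Indices start at 0 here, so the sign (-1)^(s+t-1) of the formula with      *)
(* indices starting at 1 becomes (-1)^(s+t+1).                                *)
Definition contraction_map (F : fieldType) (E W W' : vectType F) (k : nat)
    (form : {biscalar E}) (wedge : {ffun 'I_k.+2 -> E} -> W)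
    (wedge' : {ffun 'I_k -> E} -> W') (f : 'Hom(W, W')) : Prop :=
  forall w, f (wedge w) =
    \sum_(s < k.+2) \sum_(t < k.+2 | (s < t)%N)
      ((-1) ^+ (s + t).+1 * form (w s) (w t)) *: wedge' (omit2 w s t).

(* Codimension of P(U) in P(W), that is (dim W - 1) - (dim U - 1). *)
Definition proj_codim (F : fieldType) (W : vectType F) (U : {vspace W}) : nat :=
  (\dim {:W} - \dim U)%N.

(* I(l, m), as the l-element subsets of {0, ..., m-1}. *)
Definition index_set (l m : nat) : finType := {a : {set 'I_m} | #|a| == l}.

(* a U {i, 13-i}: with indices starting at 0 the partner of i is 11-i.        *)
Definition add_pair (a : {set 'I_12}) (i : 'I_12) : {set 'I_12} :=
  a :|: [set i; rev_ord i].

(* Coefficient of X_b in Pi_a. *)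
Definition plucker_coef (F : fieldType) (a b : {set 'I_12}) : F :=
  \sum_(i < 12 | (i < 6)%N)
    (#|add_pair a i| == 6%N)%:R * (add_pair a i == b)%:R.

Definition plucker_matrix (F : fieldType) :
    'M[F]_(#|index_set 4 12|, #|index_set 6 12|) :=
  \matrix_(r, c) plucker_coef F (val (enum_val r)) (val (enum_val c)).

(* Main.v *)
Require Import Defs.
From mathcomp Require Import all_boot all_order all_fingroup all_algebra.
From mathcomp Require Import zify ring.
Import GRing.Theory.
Set Implicit Arguments.
Unset Strict Implicit.
Unset Printing Implicit Defensive.
Local Open Scope ring_scope.

(* In a symplectic basis whose k-subsets are enumerated with the two members
   of each pair {i, 13-i} adjacent, every sign in the contraction map is +1, so
   the matrix of f is the transpose of the Pluecker matrix B, and only the rank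
   of B is needed. A vector v of the left kernel of B is a function on 4-sets
   whose sum over the 4-sets b \ {i, 13-i} vanishes for every 6-set b. Sort
   4-sets by the number of pairs {i, 13-i} that they contain:
   - without pairs, v(a) = 0;
   - for S of size 2 without pairs, v(S + pair i) + v(S + pair j) = 0 for all
     distinct i, j among the four free pairs, whence 2 v = 0;
   - for u(i, j) = v(pair i + pair j), u(i, j) + u(i, k) + u(j, k) = 0 for all
     distinct i, j, k among the six pairs; if 2 is invertible then u is
     constant and 3 u = 0, and in characteristic 2 it is a coboundary.
   Hence the left kernel has dimension 60 + 5 in characteristic 2, 1 in
   characteristic 3 and 0 otherwise. *)

(** * The left kernel of the Pluecker matrix *)

(** The [g t] form a basis of the left kernel. Evaluation at the coordinates [tau t] is dual to
    them, whence independence; subtracting from a kernel vector [v] the combination with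
    coefficients [v 0 (tau t)] leaves a kernel vector vanishing at all test coordinates, hence 0. *)
Lemma rank_dual_family (F : fieldType) (m n : nat) (T : finType)
    (B : 'M[F]_(m, n)) (g : T -> 'rV[F]_m) (tau : T -> 'I_m) :
    (forall t, g t *m B = 0) ->
    (forall t t', g t 0 (tau t') = (t == t')%:R) ->
    (forall v : 'rV_m, v *m B = 0 -> (forall t, v 0 (tau t) = 0) -> v = 0) ->
  \rank B = (m - #|T|)%N.
Proof.
move=> gB gtau kerB.
pose M := \matrix_(i < #|T|) g (enum_val i).
have MB0 : M *m B = 0.
  by apply/row_matrixP => i; rewrite row_mul rowK gB row0.
have freeM : row_free M.
  apply/row_freeP.
  (* Right multiplication by this matrix selects the columns [tau t], where [M] is the identity. *)
  exists (\matrix_(k < m, j < #|T|) (k == tau (enum_val j))%:R).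
  apply/matrixP => i j; rewrite !mxE (bigD1 (tau (enum_val j))) //= !mxE eqxx.
  rewrite gtau mulr1 (inj_eq enum_val_inj) big1 ?addr0 // => k kj.
  by rewrite !mxE (negPf kj) mulr0.
have kerM : (kermx B :=: M)%MS.
  apply/eqmxP/andP; split; last by apply/sub_kermxP.
  apply/rV_subP => v /sub_kermxP vB0.
  pose u : 'rV_#|T| := \row_j v 0 (tau (enum_val j)).
  suff -> : v = u *m M by apply: submxMl.
  apply/eqP; rewrite -subr_eq0; apply/eqP/kerB.
    by rewrite mulmxBl vB0 -mulmxA MB0 mulmx0 subrr.
  move=> t; rewrite !mxE (bigD1 (enum_rank t)) //= !mxE enum_rankK gtau eqxx.
  rewrite mulr1 big1 ?addr0 ?subrr // => j jt; rewrite !mxE gtau.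
  by rewrite -[t]enum_rankK (inj_eq enum_val_inj) (negPf jt) mulr0.
have := mxrank_ker B; rewrite kerM (eqP freeM).
by move: (rank_leq_row B); lia.
Qed.

(** * Decomposition of a set into full pairs and single elements *)

Definition ord_pair (x : 'I_12) : {set 'I_12} := [set x; rev_ord x].

(** Each pair is represented by its member below 6, so that cardinalities count pairs. *)
Definition full_pairs (b : {set 'I_12}) : {set 'I_12} :=
  [set i : 'I_12 | (i < 6)%N && (ord_pair i \subset b)].

Definition singles (b : {set 'I_12}) : {set 'I_12} :=
  [set x in b | rev_ord x \notin b].

Lemma rev_ord_lt6 (x : 'I_12) : (rev_ord x < 6)%N = ~~ (x < 6)%N.
Proof. by case: x => x /= ltx; lia. Qed.

Lemma rev_ord_neq (x : 'I_12) : (rev_ord x == x) = false.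
Proof. by apply/negbTE/eqP => /(congr1 val) /=; lia. Qed.

Lemma in_pair x y : (y \in ord_pair x) = (y == x) || (y == rev_ord x).
Proof. by rewrite !inE. Qed.

Lemma rev_in_pair x y : (rev_ord y \in ord_pair x) = (y \in ord_pair x).
Proof.
by rewrite !in_pair (inj_eq rev_ord_inj) (can2_eq rev_ordK rev_ordK) orbC.
Qed.

Lemma in_pair_lt6 (x y : 'I_12) :
  (x < 6)%N -> (y < 6)%N -> (y \in ord_pair x) = (y == x).
Proof.
move=> x6 y6; rewrite in_pair; case: eqVneq => //= _.
by apply/eqP => yx; move: y6; rewrite yx rev_ord_lt6 x6.
Qed.

Lemma pair_sub x (b : {set 'I_12}) :
  (ord_pair x \subset b) = (x \in b) && (rev_ord x \in b).
Proof. by rewrite subUset !sub1set. Qed.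

Lemma card_pair x : #|ord_pair x| = 2.
Proof. by rewrite cards2 eq_sym rev_ord_neq. Qed.

Lemma in_full b (i : 'I_12) :
  (i \in full_pairs b) = [&& (i < 6)%N, i \in b & rev_ord i \in b].
Proof. by rewrite inE pair_sub. Qed.

Lemma in_singles b x : (x \in singles b) = (x \in b) && (rev_ord x \notin b).
Proof. by rewrite inE. Qed.

Lemma card_singles_full (b : {set 'I_12}) :
  #|b| = (#|singles b| + #|full_pairs b|.*2)%N.
Proof.
have -> : #|b| = (#|singles b| + #|b :\: singles b|)%N.
  rewrite -(cardsID (singles b) b); congr (#|pred_of_set _| + _)%N.
  by apply/setP => x; rewrite !inE andbA andbb.
congr addn; rewrite -(cardsID [set x : 'I_12 | (x < 6)%N]) -addnn; congr addn.
  apply: eq_card => x; rewrite in_full !inE.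
  by case: (x \in b); case: (rev_ord x \in b); rewrite /= ?andbF ?andbT.
(* The paired members of [b] from 6 on are the mirror images of those below 6. *)
rewrite -(card_imset _ (@rev_ord_inj 12)); apply: eq_card => x.
apply/imsetP/idP => [[y + ->]|]; rewrite in_full ?inE ?rev_ord_lt6.
  rewrite rev_ordK.
  by case: (y \in b); case: (rev_ord y \in b); case: (_ < _)%N.
move=> /and3P[x6 xb rxb]; exists (rev_ord x); last by rewrite rev_ordK.
by rewrite !inE rev_ordK xb rxb rev_ord_lt6 x6.
Qed.

Lemma singlesD b i : i \in full_pairs b -> singles (b :\: ord_pair i) = singles b.
Proof.
rewrite inE pair_sub => /andP[_ /andP[ib rib]]; apply/setP => x.
rewrite !in_singles !in_setD rev_in_pair.
case: (boolP (x \in ord_pair i)) => //=.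
by rewrite in_pair => /orP[]/eqP->; rewrite ?rev_ordK ib rib.
Qed.

Lemma cardD_pair (b : {set 'I_12}) i :
  i \in full_pairs b -> #|b| = 6%N -> #|b :\: ord_pair i| = 4%N.
Proof.
by rewrite inE => /andP[_ ib] cb; rewrite cardsD (setIidPr ib) cb card_pair.
Qed.

Lemma card_index_set l m : #|index_set l m| = 'C(m, l).
Proof.
rewrite card_sig -[m in RHS]card_ord -card_draws.
by apply: eq_card => a; rewrite !inE.
Qed.

Section Kernel.
Variable F : fieldType.
Implicit Types (v : {set 'I_12} -> F) (a b : {set 'I_12}).

(** Adding a pair to a 4-set gives 6 elements exactly when the two are disjoint, and then [a] is
    recovered from [b] by removing the pair. *)
Lemma plucker_coefE a b : #|a| = 4%N -> #|b| = 6%N ->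
  plucker_coef F a b = \sum_(i in full_pairs b) (a == b :\: ord_pair i)%:R.
Proof.
move=> ca cb; rewrite /plucker_coef (bigID (fun i => ord_pair i \subset b)) /=.
rewrite addrC big1 ?add0r => [|i /andP[_ /negP nib]]; last first.
  case: (eqVneq (Defs.add_pair a i) b) => [ab|_]; last by rewrite mulr0.
  by case: nib; rewrite -ab subsetUr.
apply: eq_big => [i|i /andP[i6 ib]]; first by rewrite inE.
rewrite -natrM mulnb; congr (nat_of_bool _)%:R; apply/andP/eqP.
  rewrite /Defs.add_pair -/(ord_pair i) => -[c6 /eqP abE].
  have : [disjoint a & ord_pair i].
    rewrite -setI_eq0 -cards_eq0; apply/eqP.
    by have := cardsUI a (ord_pair i); rewrite (eqP c6) ca card_pair; lia.
  by rewrite -abE setDUl setDv setU0 => /setDidPl.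
move=> ->; suff -> : Defs.add_pair (b :\: ord_pair i) i = b by rewrite cb !eqxx.
by rewrite /Defs.add_pair -/(ord_pair i) setUC -[RHS](setID _ (ord_pair i))
  (setIidPr ib).
Qed.

(** The left kernel of the matrix, with row vectors replaced by functions on all sets; only their
    values at 4-sets enter. *)
Definition plucker_kernel v :=
  forall b, #|b| = 6%N -> \sum_(i in full_pairs b) v (b :\: ord_pair i) = 0.

Lemma sum_plucker_coef v b : #|b| = 6%N ->
  \sum_(a : index_set 4 12) v (val a) * plucker_coef F (val a) b =
  \sum_(i in full_pairs b) v (b :\: ord_pair i).
Proof.
move=> cb; under eq_bigr => a _ do
  rewrite (plucker_coefE (eqP (valP a)) cb) mulr_sumr.
rewrite exchange_big; apply: eq_bigr => i ib /=.
have cbi : #|b :\: ord_pair i| == 4%N by rewrite (cardD_pair ib cb).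
rewrite (bigD1 (Sub (b :\: ord_pair i) cbi : index_set 4 12)) //= eqxx mulr1
  big1 ?addr0 // => a.
by rewrite -val_eqE /= => /negPf ->; rewrite mulr0.
Qed.

(** [rank_dual_family] carried over to functions on sets; 495 is the number of 4-subsets of a
    12-set. *)
Lemma plucker_rank_dual (T : finType) (g : T -> {set 'I_12} -> F)
    (tau : T -> {set 'I_12}) :
    (forall t, #|tau t| = 4%N) -> (forall t, plucker_kernel (g t)) ->
    (forall t t', g t (tau t') = (t == t')%:R) ->
    (forall v, plucker_kernel v -> (forall t, v (tau t) = 0) ->
       forall a, #|a| = 4%N -> v a = 0) ->
  \rank (plucker_matrix F) = (495 - #|T|)%N.
Proof.
move=> ctau kg gtau kv.
have tauP t : #|tau t| == 4%N by rewrite ctau.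
have coefP v : \row_r v (val (enum_val r)) *m plucker_matrix F =
    \row_c \sum_(i in full_pairs (val (enum_val c)))
        v (val (enum_val c) :\: ord_pair i).
  apply/rowP => c; rewrite !mxE.
  rewrite -(sum_plucker_coef _ (eqP (valP (enum_val c)))).
  rewrite (reindex _ (onW_bij _ (@enum_val_bij (index_set 4 12)))) /=.
  by apply: eq_bigr => r _; rewrite !mxE.
rewrite (@rank_dual_family _ _ _ T _
  (fun t => \row_r g t (val (enum_val r))) (fun t =>
    enum_rank (Sub (tau t) (tauP t) : index_set 4 12))).
- by rewrite card_index_set; congr subn.
- move=> t; rewrite coefP; apply/rowP => c; rewrite !mxE.
  by apply: kg; apply/eqP/(valP (enum_val c)).
- by move=> t t'; rewrite mxE enum_rankK SubK gtau.
move=> r rB r0.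
(* The row vector [r] read as a function on sets, extended by 0 outside the 4-sets. *)
pose v a := if insub a is Some a' then r 0 (enum_rank (a' : index_set 4 12))
  else 0.
have rE : r = \row_k v (val (enum_val k)).
  by apply/rowP => k; rewrite mxE /v valK enum_valK.
apply/rowP => k; rewrite rE !mxE; apply: kv;
  last by apply/eqP/(valP (enum_val k)).
- move=> b /eqP cb; move: rB;
  rewrite rE coefP => /rowP/(_ (enum_rank (Sub b cb : index_set 6 12))).
  by rewrite !mxE enum_rankK.
- by move=> t; rewrite /v (insubT (fun a => #|a| == 4%N) (tauP t)) r0.
Qed.
End Kernel.

Definition free_pairs (S : {set 'I_12}) : {set 'I_12} := full_pairs (~: S).

(** Inverse of the decomposition: a set corresponds to its [singles] together with a set of pairs
    free for them. *)
Definition add_pairs (S I : {set 'I_12}) : {set 'I_12} :=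
  S :|: \bigcup_(i in I) ord_pair i.

Section Join.
Implicit Types a b S I : {set 'I_12}.

Lemma in_avail S i :
  (i \in free_pairs S) = [&& (i < 6)%N, i \notin S & rev_ord i \notin S].
Proof. by rewrite in_full !inE. Qed.

Lemma in_join S I x :
  (x \in add_pairs S I) = [|| x \in S, x \in I | rev_ord x \in I].
Proof.
rewrite inE; congr orb; apply/bigcupP/orP => [[i iI]|].
  by rewrite in_pair => /orP[]/eqP->; rewrite ?rev_ordK iI; [left | right].
by case=> xI; [exists x | exists (rev_ord x)];
  rewrite ?in_pair ?rev_ordK ?eqxx ?orbT.
Qed.

Lemma full_singles a : full_pairs (singles a) = set0.
Proof.
by apply/setP => i; rewrite in_full !in_singles rev_ordK inE; case: (i \in a);
  rewrite /= ?andbF.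
Qed.

Lemma full_sub_avail a : full_pairs a \subset free_pairs (singles a).
Proof.
apply/subsetP => i; rewrite in_full in_avail !in_singles rev_ordK.
by case/and3P=> -> -> ->.
Qed.

Lemma join_singles_full a : add_pairs (singles a) (full_pairs a) = a.
Proof.
apply/setP => x; rewrite in_join in_singles !in_full rev_ordK rev_ord_lt6.
by case: (x \in a); case: (rev_ord x \in a); case: (x < 6)%N.
Qed.

Section FullJoin.
Variables S I : {set 'I_12}.
Hypotheses (S0 : full_pairs S = set0) (IS : I \subset free_pairs S).

Let Ilow i : i \in I -> [/\ (i < 6)%N, i \notin S,
  rev_ord i \notin S & rev_ord i \notin I].
Proof.
move=> iI; move/subsetP/(_ i iI): (IS); rewrite in_avail => /and3P[i6 iS riS].
split=> //; apply/negP => riI; move/subsetP/(_ _ riI): IS.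
by rewrite in_avail rev_ord_lt6 i6.
Qed.

Lemma full_join : full_pairs (add_pairs S I) = I.
Proof.
apply/setP => i; rewrite in_full !in_join rev_ordK.
apply/and3P/idP => [[i6 iJ riJ]|iI]; last by have [-> _ _ _] := Ilow iI;
  rewrite iI !orbT.
have iI : rev_ord i \notin I by apply/negP => /Ilow[]; rewrite rev_ord_lt6 i6.
case: (boolP (i \in I)) => // niI; move/setP/(_ i): S0; rewrite in_full i6 inE.
by move: iJ riJ; rewrite (negPf iI) (negPf niI) !orbF => -> ->.
Qed.

Lemma singles_join : singles (add_pairs S I) = S.
Proof.
apply/setP => x; rewrite in_singles !in_join rev_ordK negb_or.
case: (boolP (x \in I)) => [/Ilow[_ /negPf -> _ _]|_];
  first by rewrite orbT /= andbF.
case: (boolP (rev_ord x \in I)) => [/Ilow[_ _ + _]|_].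
  by rewrite rev_ordK => /negPf ->; rewrite /= ?andbF.
rewrite !orbF andbT; case: (boolP (x \in S)) => //= xS; apply/negP => rxS.
move/setP/(_ (if (x < 6)%N then x else rev_ord x)): S0; rewrite in_full inE.
by case: ifP; rewrite ?rev_ordK ?rev_ord_lt6 => ->; rewrite xS rxS.
Qed.

Lemma card_join : #|add_pairs S I| = (#|S| + #|I|.*2)%N.
Proof. by rewrite card_singles_full full_join singles_join. Qed.
End FullJoin.

Lemma fullD b i : i \in full_pairs b -> full_pairs (b :\: ord_pair i) =
  full_pairs b :\ i.
Proof.
move=> ib; have i6 : (i < 6)%N by move: ib; rewrite in_full => /and3P[].
apply/setP => j; rewrite !inE -/(ord_pair i) !pair_sub !in_setD rev_in_pair.
case j6: (j < 6)%N; last by rewrite andbF.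
by rewrite in_pair_lt6 //; case: (j == i).
Qed.

Lemma joinD S I i : full_pairs S = set0 -> I \subset free_pairs S -> i \in I ->
  add_pairs S I :\: ord_pair i = add_pairs S (I :\ i).
Proof.
move=> S0 IS iI; rewrite -[LHS]join_singles_full.
have iJ : i \in full_pairs (add_pairs S I) by rewrite full_join.
by rewrite singlesD // fullD // full_join // singles_join.
Qed.

(** The singles of the complement of [S] are the mirror images of [S], so the complement has [#|S|]
    elements plus two for each free pair. *)
Lemma card_avail S : full_pairs S = set0 -> (#|free_pairs S| + #|S| = 6)%N.
Proof.
move=> S0; have := card_singles_full (~: S); rewrite -/(free_pairs S).
have -> : singles (~: S) = (@rev_ord 12) @: S.
  apply/setP => x; rewrite in_singles !inE negbK.
  rewrite -[x in RHS]rev_ordK (mem_imset _ _ (@rev_ord_inj 12)).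
  case: (boolP (rev_ord x \in S)) => rxS; last by rewrite andbF.
  rewrite andbT; apply/negP => xS.
  move/setP/(_ (if (x < 6)%N then x else rev_ord x)): S0; rewrite in_full inE.
  by case: ifP; rewrite ?rev_ordK ?rev_ord_lt6 => ->; rewrite xS rxS.
rewrite (card_imset _ (@rev_ord_inj 12)); have := cardsC S.
rewrite card_ord. clear. move: #|S| #|free_pairs S| #|~: S| => x y z; lia.
Qed.

Lemma full0 : full_pairs set0 = set0.
Proof. by apply/setP => i; rewrite in_full !inE !andbF. Qed.
End Join.

Lemma ex_mem_notin (T : finType) (A : {set T}) (s : seq T) :
  (size s < #|A|)%N -> exists2 x, x \in A & x \notin s.
Proof.
move=> sA; have /subsetPn[x xA xs] : ~~ (A \subset [set x in s]).
  apply/negP => /subset_leq_card; rewrite cardsE => As.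
  by have := leq_trans sA (leq_trans As (card_size s)); rewrite ltnn.
by exists x => //; rewrite inE in xs.
Qed.

(** * Consequences of the kernel equations *)

Section KernelJoin.
Variables (F : fieldType) (v : {set 'I_12} -> F).
Hypothesis kv : plucker_kernel v.
Implicit Types S I : {set 'I_12}.

Lemma kernel_join S I : full_pairs S = set0 -> I \subset free_pairs S ->
  (#|S| + #|I|.*2 = 6)%N -> \sum_(i in I) v (add_pairs S (I :\ i)) = 0.
Proof.
move=> S0 IS cSI; have := kv (b := add_pairs S I);
  rewrite card_join // full_join //.
by move=> /(_ cSI) E; rewrite -[RHS]E; apply: eq_bigr => i iI; rewrite joinD.
Qed.

(** Two pairs are free for [S]; the equation at the 6-set formed by [S] and one of them has a single
    term. *)
Lemma kernel_no_pair S : #|S| = 4%N -> full_pairs S = set0 -> v (add_pairs S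
  set0) = 0.
Proof.
move=> cS S0; have := card_avail S0; rewrite cS => cA.
have [|i iA _] := @ex_mem_notin _ (free_pairs S) [::]; first by move: cA => /=;
  lia.
have := @kernel_join S [set i] S0; rewrite sub1set iA cards1 cS => /(_ _ _)/=.
by rewrite big_set1 setDv; apply.
Qed.

Lemma kernel_one_pair S i j : #|S| = 2%N -> full_pairs S = set0 ->
    i \in free_pairs S -> j \in free_pairs S -> i != j ->
  v (add_pairs S [set i]) + v (add_pairs S [set j]) = 0.
Proof.
move=> cS S0 iA jA ij; rewrite -[RHS](@kernel_join S [set i; j]) //.
- by rewrite big_setU1 ?inE //= big_set1 setU1K ?inE // setUC setU1K ?inE
  1?eq_sym // addrC.
- by rewrite subUset !sub1set iA.
- by rewrite cS cards2 ij.
Qed.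

Let u i j := v (add_pairs set0 [set i; j]).

(** The equation at the union of three pairs. With the six pairs as vertices, [u] is a function on
    the edges of a complete graph whose sum over every triangle is 0. *)
Lemma kernel_two_pairs (i j k : 'I_12) : (i < 6)%N -> (j < 6)%N -> (k < 6)%N ->
  i != j -> i != k -> j != k -> u i j + u i k + u j k = 0.
Proof.
move=> i6 j6 k6 ij ik jk.
rewrite -[RHS](@kernel_join set0 (k |: [set i; j])) ?full0 //.
- have T0 x y z : x != y -> x != z -> (x |: [set y; z]) :\ x = [set y; z].
    by move=> xy xz; rewrite setU1K // !inE negb_or xy xz.
  rewrite !big_setU1 ?inE ?negb_or 1?(eq_sym k) ?ik ?jk //= ?(eq_sym k) ?ik ?jk
    //.
  rewrite big_set1 /u T0 1?eq_sym // (setUCA [set k]) T0 // 1?eq_sym //.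
  rewrite (setUC [set k]) (setUCA [set i]) T0 ?(eq_sym j i) // -addrA.
  by congr (_ + _); rewrite addrC.
- by apply/subsetP => x; rewrite in_avail !inE andbT; case/or3P => /eqP->.
- by rewrite cards0 cardsU1 cards2 !inE negb_or ij ![k == _]eq_sym ik jk.
Qed.

Section NotTwo.
Hypothesis two_neq0 : 2%:R != 0 :> F.

(** With further free pairs [k] and [l], the relations for [k, j] and [l, j] minus the one for
    [l, k] add up to twice the value at [j]. *)
Lemma kernel_one_pair_eq0 S j : #|S| = 2%N -> full_pairs S = set0 ->
  j \in free_pairs S -> v (add_pairs S [set j]) = 0.
Proof.
move=> cS S0 jA; have := card_avail S0; rewrite cS => cA.
have [|k kA] := @ex_mem_notin _ (free_pairs S) [:: j]; first by move: cA => /=;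
  lia.
rewrite !inE => kj.
have [|l lA] := @ex_mem_notin _ (free_pairs S) [:: j; k];
  first by move: cA => /=; lia.
rewrite !inE negb_or => /andP[lj lk].
have jkE := kernel_one_pair cS S0 kA jA kj.
have jlE := kernel_one_pair cS S0 lA jA lj.
have klE := kernel_one_pair cS S0 lA kA lk.
apply/eqP; rewrite -(mulrI_eq0 _ (lregP two_neq0)); apply/eqP.
transitivity ((v (add_pairs S [set k]) + v (add_pairs S [set j])) +
  (v (add_pairs S [set l]) + v (add_pairs S [set j])) -
  (v (add_pairs S [set l]) + v (add_pairs S [set k]))); first by ring.
by rewrite jkE jlE klE; ring.
Qed.

Let L : {set 'I_12} := free_pairs set0.
Let cL : #|L| = 6%N.
Proof. by have := card_avail full0; rewrite cards0 addn0. Qed.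
Let LE i : (i \in L) = (i < 6)%N.
Proof. by rewrite in_avail !inE !andbT. Qed.
Let uC i j : u i j = u j i. Proof. by rewrite /u setUC. Qed.

(** Among four vertices, the two triangles on the edge [i j] minus the two on the edge [k l] leave
    [2 (u i j - u k l)]. *)
Let u_disjoint (i j k l : 'I_12) : (i < 6)%N -> (j < 6)%N -> (k < 6)%N ->
  (l < 6)%N -> uniq [:: i; j; k; l] -> u i j = u k l.
Proof.
move=> i6 j6 k6 l6 /=;
  rewrite !inE !negb_or => /and4P[/and3P[ij ik il] /andP[jk jl] kl _].
apply/eqP; rewrite -subr_eq0 -(mulrI_eq0 _ (lregP two_neq0)); apply/eqP.
transitivity ((u i j + u i k + u j k) + (u i j + u i l + u j l)
  - (u i k + u i l + u k l) - (u j k + u j l + u k l)); first by ring.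
by rewrite !kernel_two_pairs //; ring.
Qed.

(** Both edges are disjoint from an edge [l m] that avoids [i], [j], [k]; six vertices leave room
    for it. *)
Let u_adjacent (i j k : 'I_12) : (i < 6)%N -> (j < 6)%N -> (k < 6)%N ->
  i != j -> i != k -> u i j = u i k.
Proof.
move=> i6 j6 k6 ij ik; case: (eqVneq j k) => [-> // | jk].
have [|l lL] := @ex_mem_notin _ L [:: i; j; k]; first by rewrite cL.
have [|m mL] := @ex_mem_notin _ L [:: i; j; k; l]; first by rewrite cL.
rewrite !LE in lL mL;
  rewrite !inE !negb_or => /and4P[mi mj mk ml] /and3P[li lj lk].
rewrite (@u_disjoint i j l m) // ?(@u_disjoint i k l m) //=;
by rewrite !inE !negb_or ?ij ?ik !(eq_sym _ l) !(eq_sym _ m) ?li ?lj ?lk ?mi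
  ?mj ?mk ?ml.
Qed.

(** Since [u] is constant, a triangle relation reads [3 u = 0]. *)
Lemma kernel_two_pairs_triple (i j : 'I_12) : (i < 6)%N -> (j < 6)%N -> i != j ->
  3%:R * v (add_pairs set0 [set i; j]) = 0.
Proof.
move=> i6 j6 ij; rewrite -/(u i j).
have [|k kL] := @ex_mem_notin _ L [:: i; j]; first by rewrite cL.
rewrite LE in kL; rewrite !inE negb_or ![k == _]eq_sym => /andP[ik jk].
rewrite -(kernel_two_pairs i6 j6 kL ij ik jk).
rewrite -(u_adjacent i6 j6 kL ij ik) (uC j k) (u_adjacent kL j6 i6) 1?eq_sym //.
by rewrite (uC k i) -(u_adjacent i6 j6 kL ij ik); ring.
Qed.

(** Values at sets with at most one pair vanish because 2 is invertible; on the others the constant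
    [u] is determined by a single value. *)
Lemma kernel_not_two_eq0 (i0 j0 : 'I_12) : (i0 < 6)%N -> (j0 < 6)%N -> i0 != j0 ->
  v (add_pairs set0 [set i0; j0]) = 0 ->
  forall a : {set 'I_12}, #|a| = 4%N -> v a = 0.
Proof.
move=> i06 j06 ij0 v0 a ca; rewrite -(join_singles_full a).
have := card_singles_full a; have := full_sub_avail a; have := full_singles a.
move: (singles a) (full_pairs a) => S I S0 IS; rewrite ca => cSI.
have [I0|I1|I2] : [\/ #|I| = 0%N, #|I| = 1%N | #|I| = 2%N].
  by move: cSI; move: #|I| #|S| => [|[|[|m]]] n;
    [constructor 1 | constructor 2 | constructor 3 | lia].
- by rewrite (cards0_eq I0) kernel_no_pair //; move: cSI; rewrite I0 addn0.
- have /cards1P[j Ij] := introT eqP I1; rewrite Ij kernel_one_pair_eq0 //.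
    by move: cSI; rewrite I1; lia.
  by rewrite -sub1set -Ij.
have /cards2P[i [j [ij Iij]]] := introT eqP I2.
have S00 : S = set0 by apply: cards0_eq; move: cSI; rewrite I2; lia.
have [i6 j6] : (i < 6)%N /\ (j < 6)%N.
  by move: IS; rewrite S00 Iij subUset !sub1set !LE => /andP[].
rewrite S00 Iij -/(u i j); rewrite -/(u i0 j0) in v0.
have u0 (k : 'I_12) : (k < 6)%N -> i0 != k -> u i0 k = 0.
  by move=> k6 ik; rewrite (@u_adjacent i0 k j0).
case: (eqVneq i0 i) => [E|ii]; first by rewrite -E u0 // E.
case: (eqVneq i0 j) => [E|jj]; first by rewrite uC -E u0 // eq_sym E.
by rewrite (@u_adjacent i j i0) ?(eq_sym i i0) // uC u0.
Qed.
End NotTwo.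
End KernelJoin.

Section KernelConverse.
Variable F : fieldType.
Implicit Types g : {set 'I_12} -> {set 'I_12} -> F.

Lemma plucker_kernel_singles_full g :
    (forall b : {set 'I_12}, #|b| = 6%N ->
       \sum_(i in full_pairs b) g (singles b) (full_pairs b :\ i) = 0) ->
  plucker_kernel (fun a => g (singles a) (full_pairs a)).
Proof.
by move=> gP b cb; rewrite -[RHS](gP b cb); apply: eq_bigr => i ib;
  rewrite singlesD ?fullD.
Qed.

(** Removing a pair keeps the singles, so the equation at a 6-set with singles [S] repeats [h S]
    once for each of its [(6 - #|S|)./2] pairs. *)
Lemma plucker_kernel_singles (h : {set 'I_12} -> F) :
    (forall S : {set 'I_12}, (#|S| <= 6)%N -> h S *+ (6 - #|S|)./2 = 0) ->
  plucker_kernel (fun a => h (singles a)).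
Proof.
move=> hP; apply: (@plucker_kernel_singles_full (fun S _ => h S)) => b cb.
have := card_singles_full b; rewrite cb => cE; rewrite sumr_const.
have sb6 : (#|singles b| <= 6)%N by rewrite [leqRHS]cE leq_addr.
by rewrite -[RHS](hP _ sb6) [X in (X - _)%N]cE addKn doubleK.
Qed.
End KernelConverse.

(** * The rank of the Pluecker matrix in each characteristic *)

Definition ord12 (k : nat) : 'I_12 := inord k.

Lemma ord12_lt6 k : (k < 6)%N -> (ord12 k < 6)%N.
Proof. by move=> k6; rewrite inordK //; lia. Qed.

Lemma ord12_eq k l : (k < 6)%N -> (l < 6)%N -> (ord12 k == ord12 l) = (k == l).
Proof. by move=> k6 l6; rewrite -val_eqE /= !inordK //; lia. Qed.

Lemma in_avail0 i : (i \in free_pairs set0) = (i < 6)%N.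
Proof. by rewrite in_avail !inE !andbT. Qed.

Section Ranks.
Variable F : fieldType.

Definition two_pairs k l : {set 'I_12} := add_pairs set0 [set ord12 k; ord12 l].

Lemma two_pairs_avail k l : (k < 6)%N -> (l < 6)%N ->
  [set ord12 k; ord12 l] \subset free_pairs set0.
Proof. by move=> k6 l6; rewrite subUset !sub1set !in_avail0 !ord12_lt6. Qed.

Lemma full_two_pairs k l : (k < 6)%N -> (l < 6)%N ->
  full_pairs (two_pairs k l) = [set ord12 k; ord12 l].
Proof. by move=> k6 l6; rewrite full_join ?full0 ?two_pairs_avail. Qed.

Lemma singles_two_pairs k l : (k < 6)%N -> (l < 6)%N ->
  singles (two_pairs k l) = set0.
Proof. by move=> k6 l6; rewrite singles_join ?full0 ?two_pairs_avail. Qed.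

Lemma card_two_pairs k l : (k < 6)%N -> (l < 6)%N -> k != l ->
  #|two_pairs k l| = 4%N.
Proof.
move=> k6 l6 kl; rewrite card_join ?full0 ?two_pairs_avail //.
by rewrite cards0 cards2 ord12_eq // kl.
Qed.

Lemma plucker_rank_generic : 2%:R != 0 :> F -> 3%:R != 0 :> F ->
  \rank (plucker_matrix F) = 495%N.
Proof.
move=> two0 three0.
rewrite (@plucker_rank_dual F void (fun=> fun=> 0) (fun=> set0)) ?card_void //;
  try by case.
move=> v kv _; apply: (@kernel_not_two_eq0 F v kv two0 (ord12 0) (ord12 1)).
- exact: ord12_lt6.
- exact: ord12_lt6.
- by rewrite ord12_eq.
apply/eqP; rewrite -(mulrI_eq0 _ (lregP three0)); apply/eqP.
by rewrite kernel_two_pairs_triple ?ord12_lt6 // ord12_eq.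
Qed.

(** The kernel is spanned by the indicator of the unions of two pairs: at a union of three pairs its
    equation reads 3 = 0. *)
Lemma plucker_rank3 : 3%N \in [pchar F] -> \rank (plucker_matrix F) = 494%N.
Proof.
move=> ch3; have three0 := pcharf0 ch3.
have two0 : 2%:R != 0 :> F by rewrite -(dvdn_pcharf ch3).
rewrite (@plucker_rank_dual F unit (fun=> fun a => (singles a == set0)%:R)
           (fun=> two_pairs 0 1)) ?card_unit //.
- by move=> _; rewrite card_two_pairs.
- move=> _; apply: (@plucker_kernel_singles F (fun S => (S == set0)%:R)) => S _.
  by case: eqP => [->|_]; rewrite ?mul0rn // cards0.
- by move=> [] []; rewrite singles_two_pairs ?eqxx.
move=> v kv /(_ tt) v0;
  apply: (@kernel_not_two_eq0 F v kv two0 (ord12 0) (ord12 1)) => //.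
- exact: ord12_lt6.
- exact: ord12_lt6.
- by rewrite ord12_eq.
Qed.

Definition single2 := {S : {set 'I_12} | (#|S| == 2%N) && (full_pairs S == set0)}.

(** Of the 66 two-element sets, the 6 pairs are excluded. *)
Lemma card_single2 : #|{: single2}| = 60%N.
Proof.
rewrite card_sig.
have := cardsID [set S : {set 'I_12} | full_pairs S == set0] [set S : {set
  'I_12} | #|S| == 2%N].
have -> : #|[set S : {set 'I_12} | #|S| == 2%N]| = 66%N.
  by rewrite card_draws card_ord.
have -> : [set S : {set 'I_12} | #|S| == 2%N] :\: [set S : {set 'I_12} |
  full_pairs S == set0] =
    ord_pair @: free_pairs set0.
  apply/setP => S; rewrite !inE;
    apply/andP/imsetP => [[/set0Pn[i iS] cS]|[i i6 ->]].
    exists i; first by move: iS; rewrite in_full in_avail0 => /andP[].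
    apply/eqP; rewrite eq_sym eqEcard (eqP cS) card_pair andbT.
    by move: iS; rewrite inE => /andP[].
  rewrite card_pair; split=> //; apply/set0Pn; exists i.
  by rewrite inE subxx andbT -in_avail0.
rewrite card_in_imset; last first.
  move=> i j; rewrite !in_avail0 => i6 j6 ij; apply/eqP.
  by rewrite -(in_pair_lt6 j6 i6) -ij in_pair eqxx.
have := card_avail full0; rewrite cards0 addn0 => ->.
have -> : #|[set S : {set 'I_12} | #|S| == 2%N] :&: [set S : {set 'I_12} |
  full_pairs S == set0]| =
  #|[pred S : {set 'I_12} | (#|S| == 2%N) && (full_pairs S == set0)]|.
  by apply: eq_card => S; rewrite !inE.
by move=> E; apply/eqP; rewrite -(eqn_add2r 6) E.
Qed.

(** Fixes a pair to test at. The default is never reached for [S] in [single2], which has four free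
    pairs. *)
Definition first_avail (S : {set 'I_12}) : 'I_12 := odflt ord0 [pick i in
  free_pairs S].

Lemma first_availP (S : single2) : first_avail (val S) \in free_pairs (val S).
Proof.
rewrite /first_avail; case: pickP => //= A0.
have /andP[/eqP cS /eqP S0] := valP S; have := card_avail S0.
by rewrite cS eq_card0.
Qed.

Definition kernel2_index := ('I_5 + single2)%type.

(** On unions of two pairs, [inl i] is the coboundary of the vertex [i.+1]: it is 1 on the edges at
    that vertex. Vertex 0 is left out because the six coboundaries sum to 0 in characteristic 2. *)
Definition kernel2_vector (t : kernel2_index) (a : {set 'I_12}) : F :=
  match t with
  | inl i => ((singles a == set0) && (ord12 i.+1 \in full_pairs a))%:R
  | inr s => (singles a == val s)%:R
  end.

(** The edge from 0 to [i.+1] meets, among the vertices [1, ..., 5], only [i.+1], which makes these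
    tests dual to the coboundaries. *)
Definition kernel2_test (t : kernel2_index) : {set 'I_12} :=
  match t with
  | inl i => two_pairs 0 i.+1
  | inr s => add_pairs (val s) [set first_avail (val s)]
  end.

Lemma singles_kernel2_test (S : single2) : singles (kernel2_test (inr S)) = val S.
Proof. by have /andP[_ /eqP S0] := valP S;
  rewrite singles_join // sub1set first_availP. Qed.

Lemma plucker_rank2 : 2%N \in [pchar F] -> \rank (plucker_matrix F) = 430%N.
Proof.
move=> ch2; have two0 := pcharf0 ch2.
have i5 (i : 'I_5) : (i.+1 < 6)%N by rewrite ltnS.
rewrite (@plucker_rank_dual F kernel2_index kernel2_vector kernel2_test);
  first by rewrite card_sum card_single2 card_ord.
- case=> [i|S]; first by rewrite card_two_pairs.
  have /andP[/eqP cS /eqP S0] := valP S.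
  by rewrite card_join // ?sub1set ?first_availP // cS cards1.
- case=> [i|S].
    pose g := fun S I : {set 'I_12} => ((S == set0) && (ord12 i.+1 \in I))%:R : F.
    apply: (@plucker_kernel_singles_full F g) => b cb.
    rewrite /g; case: eqP => [sb|_] /=; last by rewrite big1.
    have := card_singles_full b; rewrite sb cards0 cb => cf.
    case ib: (ord12 i.+1 \in full_pairs b); last first.
      by rewrite big1 // => j _; rewrite in_setD1 ib andbF.
    (* Of three pairs, removing the chosen one gives 0 and removing either of the others gives 1;
       the total is 2 = 0. *)
    rewrite (bigD1 (ord12 i.+1)) //= in_setD1 eqxx /= add0r.
    rewrite (eq_bigr (fun=> 1)) => [|j /andP[_ ji]]; last first.
      by rewrite in_setD1 ib eq_sym ji.
    rewrite sumr_const.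
    have -> : #|[pred j | (j \in full_pairs b) && (j != ord12 i.+1)]| = 2%N.
      have := cardsD1 (ord12 i.+1) (full_pairs b); rewrite ib => E.
      have -> : #|[pred j | (j \in full_pairs b) && (j != ord12 i.+1)]| =
        #|full_pairs b :\ ord12 i.+1|.
        by apply: eq_card => j; rewrite !inE andbC.
      by move: E cf; move: #|full_pairs b| #|full_pairs b :\ _| => m n; lia.
    exact: two0.
  apply: (@plucker_kernel_singles F (fun S' => (S' == val S)%:R)) => S' _.
  have /andP[/eqP cS _] := valP S.
  by case: eqP => [->|_]; rewrite ?mul0rn // cS.
- case=> [i|S] [j|S'] /=.
  + rewrite singles_two_pairs // eqxx full_two_pairs // !inE.
    by rewrite !ord12_eq.
  + rewrite -/(kernel2_test (inr S')) singles_kernel2_test.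
    have /andP[/eqP cS _] := valP S'.
    by case: eqP => // S0; move: cS; rewrite S0 cards0.
  + rewrite singles_two_pairs //; have /andP[/eqP cS _] := valP S.
    by case: eqP => // S0; move: cS; rewrite -[val S]S0 cards0.
  + by rewrite -/(kernel2_test (inr S')) singles_kernel2_test eq_sym.
move=> v kv v0 a ca; rewrite -(join_singles_full a).
have := card_singles_full a; have := full_sub_avail a; have := full_singles a.
move: (singles a) (full_pairs a) => S I S0 IS; rewrite ca => cSI.
have [I0|I1|I2] : [\/ #|I| = 0%N, #|I| = 1%N | #|I| = 2%N].
  by move: cSI; move: #|I| #|S| => [|[|[|m]]] n;
    [constructor 1 | constructor 2 | constructor 3 | lia].
- by rewrite (cards0_eq I0) kernel_no_pair //; move: cSI; rewrite I0 addn0.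
- have /cards1P[j Ij] := introT eqP I1.
  have cS : #|S| = 2%N by move: cSI; rewrite I1; lia.
  have SP : (#|S| == 2%N) && (full_pairs S == set0) by rewrite cS S0 !eqxx.
  have := v0 (inr (Sub S SP : single2)); rewrite /=.
  have := first_availP (Sub S SP : single2); move=> /= fA vS.
  rewrite Ij; case: (eqVneq (first_avail S) j) => [<- //|fj].
  have jA : j \in free_pairs S by rewrite -sub1set -Ij.
  (* The values at two free pairs are opposite, so vanishing at the tested pair suffices. *)
  by have := kernel_one_pair kv cS S0 fA jA fj; rewrite vS add0r.
have /cards2P[i [j [ij Iij]]] := introT eqP I2.
have S00 : S = set0 by apply: cards0_eq; move: cSI; rewrite I2; lia.
have [i6 j6] : (i < 6)%N /\ (j < 6)%N.
  by move: IS; rewrite S00 Iij subUset !sub1set !in_avail0 => /andP[].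
have u0 (k : 'I_12) : (k < 6)%N -> ord12 0 != k -> v (add_pairs set0 [set ord12
  0; k]) = 0.
  move=> k6 k0.
  have k1 : (0 < k)%N.
    by case: posnP => // k00; case/eqP: k0; apply: val_inj; rewrite /= inordK.
  have k5 : (k.-1 < 5)%N by lia.
  have := v0 (inl (Ordinal k5)); rewrite /= /two_pairs prednK //.
  by rewrite /ord12 inord_val.
rewrite S00 Iij; case: (eqVneq (ord12 0) i) => [E|i0];
  first by rewrite -E u0 // E.
case: (eqVneq (ord12 0) j) => [E|j0]; first by rewrite -E setUC u0.
(* The triangle on 0, [i], [j] has two edges at vertex 0, where [v] vanishes by the tests. *)
have := kernel_two_pairs kv (ord12_lt6 (isT : 0 < 6)%N) i6 j6 i0 j0 ij.
by rewrite !u0 // !add0r.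
Qed.
End Ranks.

(** * Bases of exterior powers *)

Section Multilinear.
Variables (F : fieldType) (E V : lmodType F) (k : nat).
Implicit Types (m : {ffun 'I_k -> E} -> V) (w : {ffun 'I_k -> E}).

Lemma replace_arg_id w i : replace_arg w i (w i) = w.
Proof. by apply/ffunP => j; rewrite ffunE; case: eqP => [->|]. Qed.

Lemma multilinear_sum m w i (J : finType) (a : J -> F) (x : J -> E) :
  multilinear_map m ->
  m (replace_arg w i (\sum_j a j *: x j)) = \sum_j a j *: m (replace_arg w i (x
    j)).
Proof.
move=> /(_ w i) lg; set g := fun x => m (replace_arg w i x) in lg *.
have gD : {morph g : y z / y + z} by move=> y z; have := lg 1 y z;
  rewrite !scale1r.
have g0 : g 0 = 0 by apply: (addIr (g 0)); rewrite -gD !add0r.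
rewrite -[LHS]/(g _) (big_morph g gD g0); apply: eq_bigr => j _.
by have := lg (a j) (x j) 0; rewrite g0 !addr0.
Qed.

Lemma multilinearD m w i x y : multilinear_map m ->
  m (replace_arg w i (x + y)) = m (replace_arg w i x) + m (replace_arg w i y).
Proof. by move=> /(_ w i 1 x y); rewrite !scale1r. Qed.

Definition permute_args w (s : 'S_k) : {ffun 'I_k -> E} := [ffun i => w (s i)].

(** Polarization: expand [g x x = 0] at [x = w i + w j]. *)
Lemma alternating_tperm m w i j : multilinear_map m -> alternating_map m ->
  i != j -> m (permute_args w (tperm i j)) = - m w.
Proof.
move=> ml alt ij.
pose g x y := m (replace_arg (replace_arg w i x) j y).
have repC x y : replace_arg (replace_arg w i x) j y = replace_arg (replace_arg
  w j y) i x.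
  apply/ffunP => l; rewrite !ffunE; case: eqVneq => [->|//].
  by rewrite eq_sym (negPf ij).
have gDl x x' y : g (x + x') y = g x y + g x' y by rewrite /g !repC multilinearD.
have gDr x y y' : g x (y + y') = g x y + g x y' by rewrite /g multilinearD.
have gxx x : g x x = 0.
  by apply: (alt _ i j ij); rewrite !ffunE !eqxx (negPf ij).
have -> : w = replace_arg (replace_arg w i (w i)) j (w j) by rewrite
  !replace_arg_id.
rewrite -/(g _ _).
have -> : permute_args (replace_arg (replace_arg w i (w i)) j (w j)) (tperm i j) =
    replace_arg (replace_arg w i (w j)) j (w i).
  apply/ffunP => l; rewrite !replace_arg_id !ffunE.
  by case: tpermP => [->|->|/eqP/negPf li /eqP/negPf lj];
    rewrite ?eqxx ?(negPf ij) ?li ?lj.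
apply/eqP; rewrite -addr_eq0 -/(g _ _) addrC; apply/eqP.
by have := gxx (w i + w j); rewrite gDl !gDr !gxx add0r addr0.
Qed.

Lemma alternating_perm m w (s : 'S_k) : multilinear_map m -> alternating_map m ->
  m (permute_args w s) = (-1) ^+ s *: m w.
Proof.
move=> ml alt; case: (prod_tpermP s) => ts -> {s}.
elim: ts w => [|[i j] ts IH] w /=.
  rewrite big_nil odd_perm1 expr0 scale1r => _; congr (m _).
  by apply/ffunP => l; rewrite ffunE perm1.
case/andP => /= ij tsP; rewrite big_cons odd_permM odd_tperm ij signr_addb expr1.
have -> : permute_args w (tperm i j * \prod_(t <- ts) tperm t.1 t.2)%g =
    permute_args (permute_args w (\prod_(t <- ts) tperm t.1 t.2)%g) (tperm i j).
  by apply/ffunP => l; rewrite !ffunE permM.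
by rewrite alternating_tperm // IH // mulN1r scaleNr.
Qed.
End Multilinear.

Section ExteriorBasis.
Variables (F : fieldType) (E : vectType F) (n k : nat) (X : n.-tuple E).
Hypothesis basisX : basis_of fullv X.

Definition basis_args (phi : 'I_k -> 'I_n) : {ffun 'I_k -> E} :=
  [ffun i => X`_(phi i)].

Lemma multilinear_eq0 (V : lmodType F) (m : {ffun 'I_k -> E} -> V) :
  multilinear_map m -> (forall phi : {ffun 'I_k -> 'I_n},
    m (basis_args phi) = 0) ->
  forall w, m w = 0.
Proof.
move=> ml m0 w.
(* Induction on [j], where only the arguments with index below [j] may fail to be basis vectors. *)
suff H j : (j <= k)%N -> forall w : {ffun 'I_k -> E},
    (forall i : 'I_k, (j <= i)%N -> exists x, w i = X`_(x : 'I_n)) -> m w = 0.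
  by apply: (H k) => // i; rewrite leqNgt ltn_ord.
elim: j => [_|j IH jk] {}w wX.
  have /fin_all_exists[phi phiE] i : exists x : 'I_n, w i = X`_x by apply: wX.
  by rewrite -(m0 (finfun phi)); congr m; apply/ffunP => i; rewrite !ffunE.
rewrite -(replace_arg_id w (Ordinal jk)).
rewrite [w (Ordinal jk)](coord_basis basisX (memvf _)) multilinear_sum //.
rewrite big1 // => x _; rewrite IH ?scaler0 ?(ltnW jk) // => i ji.
rewrite ffunE; case: eqVneq => [_|ij]; first by exists x.
apply: wX; rewrite ltn_neqAle ji andbT; apply: contra ij => /eqP E'.
exact/eqP/val_inj.
Qed.

(** The minor of the coordinate matrix on the columns [phi]. These minors induce the dual basis of
    the wedge products of basis vectors. *)
Definition coord_det (phi : 'I_k -> 'I_n) (w : {ffun 'I_k -> E}) : F^o :=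
  \det (\matrix_(i, j) coord X (phi j) (w i)).

Lemma coord_det_multilinear phi : multilinear_map (coord_det phi).
Proof.
move=> w i a x y /=; rewrite /coord_det -[_ (\det _) + _]/(_ * _ + _).
rewrite -[X in _ = _ + X]mul1r; apply: (@determinant_multilinear _ _ _ _ _ i).
- by apply/rowP => j; rewrite !mxE !ffunE eqxx linearP mul1r.
- by apply/matrixP => l j; rewrite !mxE !ffunE eq_sym (negPf (neq_lift _ _)).
- by apply/matrixP => l j; rewrite !mxE !ffunE eq_sym (negPf (neq_lift _ _)).
Qed.

Lemma coord_det_alternating phi : alternating_map (coord_det phi).
Proof.
by move=> w i j ij wij; apply: (determinant_alternate ij) => l; rewrite !mxE wij.
Qed.

Lemma coord_det_basis phi psi :
  coord_det phi (basis_args psi) = \det (\matrix_(i, j) (psi i == phi j)%:R).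
Proof.
congr (\det _); apply/matrixP => i j; rewrite !mxE ffunE coord_free //.
exact: basis_free basisX.
Qed.

(* [t] lists each [k]-subset of ['I_n] once, in an arbitrary order. *)
Variables (I : finType) (t : I -> {ffun 'I_k -> 'I_n}).
Hypothesis t_inj : forall a, injective (t a).
Hypothesis t_neq : forall a b, a != b -> exists i, forall j, t b i != t a j.
Hypothesis t_all : forall phi : 'I_k -> 'I_n, injective phi ->
  exists a, exists s : 'S_k, forall i, phi i = t a (s i).

(** The matrix is the identity if the two subsets agree and has a zero row otherwise. *)
Lemma coord_det_dual a b : coord_det (t a) (basis_args (t b)) = (b == a)%:R.
Proof.
rewrite coord_det_basis; case: (eqVneq b a) => [->|ba].
  rewrite -[RHS](det1 F k); congr (\det _); apply/matrixP => i j.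
  by rewrite !mxE (inj_eq (@t_inj a)).
have [|i iP] := @t_neq a b; first by rewrite eq_sym.
rewrite (expand_det_row _ i) big1 // => j _.
by rewrite mxE (negPf (iP j)) mul0r.
Qed.

(** A tuple of basis vectors either repeats an argument or is a reordering of some [t a], which only
    costs a sign. *)
Lemma alternating_eq0 (V : lmodType F) (m : {ffun 'I_k -> E} -> V) :
  multilinear_map m -> alternating_map m ->
  (forall a, m (basis_args (t a)) = 0) -> forall w, m w = 0.
Proof.
move=> ml alt m0; apply: multilinear_eq0 => // phi.
case: (injectiveP phi) => [/t_all[a [s phiE]]|ninj].
  have -> : basis_args phi = permute_args (basis_args (t a)) s.
    by apply/ffunP => i; rewrite !ffunE phiE.
  by rewrite alternating_perm // m0 scaler0.
have /injectivePn[i [j ij phiij]] : ~~ injectiveb phi by apply/injectiveP.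
by apply: (alt _ i j ij); rewrite !ffunE phiij.
Qed.

Variables (W : vectType F) (wedge : {ffun 'I_k -> E} -> W).
Hypothesis extW : exterior_power wedge.

Definition wedge_basis : #|I|.-tuple W :=
  [tuple wedge (basis_args (t (enum_val i))) | i < #|I|].

Lemma wedge_basisE a : wedge_basis`_(enum_rank a) = wedge (basis_args (t a)).
Proof. by rewrite nth_mktuple enum_rankK. Qed.

(** The universal property turns each [coord_det] into a linear form that extracts one coefficient
    of a linear relation. *)
Lemma wedge_basis_free : free wedge_basis.
Proof.
have [_ _ univ] := extW.
apply/freeP => c c0 i.
have [h hE _] := univ _ _ (@coord_det_multilinear (t (enum_val i)))
  (@coord_det_alternating _).
have := congr1 h c0; rewrite linear_sum linear0 (bigD1 i) //= big1 => [|j ji].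
  by rewrite linearZ nth_mktuple hE coord_det_dual eqxx addr0 => <-;
    rewrite [RHS]mulr1.
rewrite linearZ nth_mktuple hE coord_det_dual (inj_eq enum_val_inj) (negPf ji).
exact: scaler0.
Qed.

(* [1 - projv U] and [0] extend the same alternating map, so they agree. *)
Lemma wedge_basis_span : <<wedge_basis>>%VS = fullv.
Proof.
have [ml alt univ] := extW; set U := <<_>>%VS.
pose g : 'Hom(W, W) := (\1 - projv U)%VF.
have mlg : multilinear_map (g \o wedge).
  by move=> w i a x y; rewrite /= ml linearP.
have altg : alternating_map (g \o wedge).
  by move=> w i j ij wij; rewrite /= (alt _ _ _ ij wij) linear0.
have g0 w : g (wedge w) = 0.
  apply: (alternating_eq0 mlg altg) => a /=.
  rewrite add_lfunE opp_lfunE id_lfunE projv_id ?subrr //.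
  by rewrite -wedge_basisE; apply/memv_span/mem_nth; rewrite size_tuple.
have [h _ hU] := univ _ _ mlg altg.
have gh : g =1 h by apply: hU.
have zh : (0 : 'Hom(W, W)) =1 h by apply: hU => w; rewrite /= g0 lfunE.
apply/eqP; rewrite eqEsubv subvf; apply/subvP => x _.
have : g x = 0 by rewrite gh -zh lfunE.
rewrite add_lfunE opp_lfunE id_lfunE => /eqP; rewrite subr_eq0 => /eqP ->.
exact: memv_proj.
Qed.

Lemma wedge_basisP : basis_of fullv wedge_basis.
Proof. by rewrite /basis_of wedge_basis_span eqxx wedge_basis_free. Qed.
End ExteriorBasis.

(** * The matrix of the contraction map *)

(** Coordinate rows with respect to [X] identify the kernel of [f] with the left kernel of [M]; a
    row base of the latter is mapped to a basis. *)
Lemma dim_lker_matrix (F : fieldType) (U V : vectType F) (m n : nat)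
    (X : m.-tuple U) (Y : n.-tuple V) (f : 'Hom(U, V)) (M : 'M[F]_(m, n)) :
    basis_of fullv X -> basis_of fullv Y ->
    (forall i : 'I_m, f X`_i = \sum_j M i j *: Y`_j) ->
  \dim (lker f) = (m - \rank M)%N.
Proof.
move=> bX bY fX; rewrite -mxrank_ker.
pose vec (u : 'rV[F]_m) := \sum_i u 0 i *: X`_i.
have f_vec u : f (vec u) = \sum_j (u *m M) 0 j *: Y`_j.
  rewrite linear_sum; under eq_bigr => i _ do rewrite linearZ /= fX scaler_sumr.
  rewrite exchange_big; apply: eq_bigr => j _ /=; rewrite mxE scaler_suml.
  by apply: eq_bigr => i _; rewrite scalerA.
have freeX := freeP (basis_free bX); have freeY := freeP (basis_free bY).
have vec_inj u : vec u = 0 -> u = 0.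
  by move=> /freeX u0; apply/rowP => i; rewrite u0 mxE.
pose K := row_base (kermx M).
have KM : K *m M = 0 by apply/sub_kermxP; rewrite eq_row_base.
have vecM (c : 'rV_(\rank (kermx M))) : vec (c *m K) = \sum_i c 0 i *: vec (row
  i K).
  rewrite /vec; under eq_bigr => i _ do rewrite mxE scaler_suml.
  rewrite exchange_big; apply: eq_bigr => j _ /=; rewrite scaler_sumr.
  by apply: eq_bigr => i _; rewrite [row j K 0 i]mxE scalerA.
pose Z := [tuple vec (row i K) | i < \rank (kermx M)].
suff bZ : basis_of (lker f) Z by rewrite (size_basis bZ).
rewrite /basis_of; apply/andP; split.
  rewrite eqEsubv; apply/andP; split.
    apply/span_subvP => z /mapP[i _ ->]; rewrite memv_ker f_vec -row_mul KM.
    by rewrite row0 big1 // => j _; rewrite mxE scale0r.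
  apply/subvP => x; rewrite memv_ker => /eqP fx0.
  pose u := \row_i coord X i x.
  have xE : x = vec u.
    rewrite [LHS](coord_basis bX (memvf x)).
    by apply: eq_bigr => i _; rewrite mxE.
  have /submxP[c uE] : (u <= K)%MS.
    rewrite eq_row_base; apply/sub_kermxP/rowP => j; rewrite [RHS]mxE.
    by move: j; apply: freeY; rewrite -f_vec -xE.
  rewrite xE uE vecM; apply: memv_suml => i _; apply/memvZ/memv_span.
  by apply/mapP; exists i; rewrite ?mem_enum.
apply/freeP => c; under eq_bigr => i _ do rewrite nth_mktuple.
move=> c0 i; have := vecM (\row_j c j).
under eq_bigr => j _ do rewrite mxE; rewrite c0 => /vec_inj.
move/(congr1 (mulmx^~ (pinvmx K))); rewrite mulmxKp ?row_base_free // mul0mx.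
by move/rowP/(_ i); rewrite !mxE.
Qed.

(** * Existence of a symplectic basis *)

Section SymplecticBasis.
Variables (F : fieldType) (E : vectType F) (form : {biscalar E}).
Hypothesis sympE : symplectic form.

Lemma symplectic_anti x y : form y x = - form x y.
Proof.
have [alt _] := sympE; apply/eqP; rewrite -addr_eq0 addrC; apply/eqP.
by have := alt (x + y); rewrite linearDl !linearDr !alt add0r addr0.
Qed.

Lemma symplectic_nondeg x : x != 0 -> exists y, form x y != 0.
Proof.
have [_ nondeg] := sympE => x0.
(* Searching a finite basis makes the existence decidable. *)
have [/existsP[i fi]|] := boolP [exists i : 'I_(\dim {:E}),
  form x (vbasis fullv)`_i != 0].
  by eexists; exact: fi.
rewrite negb_exists => /forallP fx0; case/eqP: x0; apply: nondeg => y.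
rewrite (coord_vbasis (memvf y)) linear_sumr big1 // => i _.
by rewrite linearZr_LR /=; have := fx0 i; rewrite negbK => /eqP ->; rewrite mulr0.
Qed.

Definition hyperbolic_pairs k (a b : 'I_k -> E) :=
  forall i j, [/\ form (a i) (a j) = 0, form (b i) (b j) = 0
    & form (a i) (b j) = (i == j)%:R].

Lemma hyperbolic_complement k (a b : 'I_k -> E) x : hyperbolic_pairs a b ->
  exists2 y, (forall i, form y (a i) = 0 /\ form y (b i) = 0)
    & x - y \in <<codom a ++ codom b>>%VS.
Proof.
move=> hab.
(* The component of [x] in the span of the pairs; the minus sign compensates
   [form (b i) (a i) = -1]. *)
pose z := \sum_i form x (b i) *: a i - \sum_i form x (a i) *: b i.
have sumE (c : 'I_k -> F) i : \sum_j c j * (j == i)%:R = c i.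
  rewrite (bigD1 i) //= eqxx mulr1 big1 ?addr0 // => j /negPf ->.
  exact: mulr0.
have za i : form z (a i) = form x (a i).
  rewrite /z linearBl !linear_sumlz big1 => [|j _]; last first.
    by rewrite linearZl_LR; have [-> _ _] := hab j i; apply: mulr0.
  rewrite sub0r -sumrN -[RHS](sumE (fun j => form x (a j))).
  apply: eq_bigr => j _; rewrite linearZl_LR /= (symplectic_anti (a i)).
  by have [_ _ ->] := hab i j; rewrite mulrN opprK eq_sym.
have zb i : form z (b i) = form x (b i).
  rewrite /z linearBl !linear_sumlz [X in _ - X]big1 => [|j _]; last first.
    by rewrite linearZl_LR; have [_ -> _] := hab j i; apply: mulr0.
  rewrite subr0 -[RHS](sumE (fun j => form x (b j))).
  by apply: eq_bigr => j _; rewrite linearZl_LR /=; have [_ _ ->] := hab j i.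
have zS : z \in <<codom a ++ codom b>>%VS.
  by apply: rpredB; apply: memv_suml => i _; apply/memvZ/memv_span;
    rewrite mem_cat codom_f ?orbT.
clearbody z; exists (x - z); last by rewrite opprB addrC subrK.
by move=> i; rewrite !linearBl za zb !subrr.
Qed.

(** Gram-Schmidt for pairs: [y] is the part orthogonal to the span of a vector outside it, hence
    nonzero. If [form y z] is nonzero, the orthogonal part [w] of [z] has the same product with [y],
    and rescaling [w] completes the new pair. *)
Lemma hyperbolic_pairs_ex k : (k.*2 <= \dim {:E})%N ->
  exists a, exists b, @hyperbolic_pairs k a b.
Proof.
elim: k => [_|k IH dimk]; first by exists (fun=> 0), (fun=> 0); case.
have [|a [b hab]] := IH; first by move: dimk; rewrite doubleS; lia.
have [alt _] := sympE.
have [x xab] : exists x, x \notin <<codom a ++ codom b>>%VS.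
  have /subvPn[x _ xab] : ~~ ({:E} <= <<codom a ++ codom b>>)%VS.
    apply/negP => /dimvS dE; have := leq_trans dE (dim_span _).
    rewrite size_cat !size_codom !card_ord addnn => dE'.
    by have := leq_trans dimk dE'; rewrite doubleS; lia.
  by exists x.
have [y yab xy] := hyperbolic_complement x hab.
have y0 : y != 0 by apply: contraNneq xab => y0;
  rewrite -[x]subr0 -[X in x - X]y0.
have [z yz] := symplectic_nondeg y0.
have [w wab zw] := hyperbolic_complement z hab.
have yw : form y w = form y z.
  suff : form y (z - w) = 0.
    by rewrite linearBr => /eqP; rewrite subr_eq0 => /eqP.
  rewrite (@coord_span _ _ _ (in_tuple _) _ zw) linear_sumr big1 // => i _;
    rewrite linearZr_LR /=.
  have : (in_tuple (codom a ++ codom b))`_i \in codom a ++ codom b by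
    apply/mem_nth/ltn_ord.
  by rewrite mem_cat => /orP[]/codomP[j ->]; have [ya yb] := yab j;
    rewrite ?ya ?yb mulr0.
pose w' := (form y w)^-1 *: w.
have yw' : form y w' = 1 by rewrite linearZr_LR /= mulVf // yw.
have w'ab i : form w' (a i) = 0 /\ form w' (b i) = 0.
  by have [wa wb] := wab i; rewrite !linearZl_LR /= wa wb !mulr0.
exists (fun i => if unlift ord_max i is Some j then a j else y).
exists (fun i => if unlift ord_max i is Some j then b j else w').
move=> i j; case: unliftP => [i' ->|->]; case: unliftP => [j' ->|->].
- by have [-> -> ->] := hab i' j'; rewrite (inj_eq (@lift_inj _ ord_max)).
- have [ya yb] := yab i'; have [wa wb] := w'ab i';
  rewrite eq_sym (negPf (neq_lift _ _)).
  by split; rewrite symplectic_anti ?ya ?wb ?wa oppr0.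
- have [ya yb] := yab j'; have [wa wb] := w'ab j'; rewrite (negPf (neq_lift _ _)).
  by rewrite ya wb yb.
- by rewrite !alt yw' eqxx.
Qed.

(* The basis is (a_0, ..., a_5, b_5, ..., b_0) for hyperbolic pairs (a_i, b_i). *)
Lemma symplectic_basis_ex : \dim {:E} = 12%N ->
  exists2 X : 12.-tuple E, basis_of fullv X &
    forall i j : 'I_12, (i < 6)%N || (j != rev_ord i) ->
      form X`_i X`_j = (j == rev_ord i)%:R.
Proof.
move=> dimE; have [|a [b hab]] := @hyperbolic_pairs_ex 6; first by rewrite dimE.
pose e (i : 'I_12) := if (i < 6)%N then a (inord i) else b (inord (rev_ord i)).
pose X := [tuple e i | i < 12].
(* The hypothesis leaves out only the products of some [b i] with its [a i], which equal -1. *)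
have formX (i j : 'I_12) : (i < 6)%N || (j != rev_ord i) ->
    form X`_i X`_j = (j == rev_ord i)%:R.
  rewrite !nth_mktuple /e => ij.
  have inordE (x y : 'I_12) : (x < 6)%N -> (y < 6)%N -> (inord x == inord y :>
    'I_6) = (x == y).
    by move=> x6 y6; rewrite -val_eqE /= !inordK.
  have [i6|i6] := boolP (i < 6)%N; have [j6|j6] := boolP (j < 6)%N.
  - have [-> _ _] := hab (inord i) (inord j); case: eqP => // E'.
    by move: j6; rewrite E' rev_ord_lt6 i6.
  - have [_ _ ->] := hab (inord i) (inord (rev_ord j)).
    by rewrite inordE ?rev_ord_lt6 // eq_sym (can2_eq rev_ordK rev_ordK).
  - move: ij; rewrite (negPf i6) /= => ij; rewrite (negPf ij) symplectic_anti.
    have [_ _ ->] := hab (inord j) (inord (rev_ord i)).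
    by rewrite inordE ?rev_ord_lt6 // (negPf ij) oppr0.
  - have [_ -> _] := hab (inord (rev_ord i)) (inord (rev_ord j));
    case: eqP => // E'.
    by move: j6; rewrite E' rev_ord_lt6 (negPf i6).
exists X => //; rewrite basisEfree subvf size_tuple dimE leqnn !andbT.
apply/freeP => c c0 i.
(* Pairing a linear relation with the partner of the [i]-th vector isolates the [i]-th
   coefficient. *)
have [r rE] : exists r, r = rev_ord i by exists (rev_ord i).
have := congr1 (fun x => form x X`_r) c0.
rewrite linear_sumlz linear0l (bigD1 i) //= big1 => [|j ji]; last first.
  have rj : (r == rev_ord j) = false.
    by rewrite rE (inj_eq rev_ord_inj) eq_sym (negPf ji).
  by rewrite linearZl_LR /= formX rj ?orbT //= mulr0.
rewrite addr0 linearZl_LR /= => /eqP; rewrite mulf_eq0 => /orP[/eqP//|].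
case i6: (i < 6)%N; first by rewrite formX ?i6 // rE eqxx oner_eq0.
rewrite symplectic_anti formX rE ?rev_ord_lt6 ?i6 // rev_ordK eqxx oppr_eq0.
by rewrite oner_eq0.
Qed.
End SymplecticBasis.

(** * Paired enumeration of subsets and the contraction of wedge products *)

Definition paired_order : seq 'I_12 :=
  flatten [seq [:: ord12 i; rev_ord (ord12 i)] | i <- iota 0 6].

Definition paired_enum (a : {set 'I_12}) : seq 'I_12 :=
  [seq x <- paired_order | x \in a].

Lemma map_val_paired_order :
  map val paired_order = [:: 0; 11; 1; 10; 2; 9; 3; 8; 4; 7; 5; 6]%N.
Proof. by rewrite /= /ord12 !inordK. Qed.

Lemma paired_order_uniq : uniq paired_order.
Proof. by rewrite -(map_inj_uniq val_inj) map_val_paired_order. Qed.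

Lemma mem_paired_order x : x \in paired_order.
Proof.
have := uniq_min_size paired_order_uniq (s2 := enum 'I_12).
have sO : size paired_order = 12%N by rewrite -(size_map val)
  map_val_paired_order.
case=> [y _||_ E]; rewrite ?mem_enum //; first by rewrite size_enum_ord sO.
by rewrite E mem_enum.
Qed.

Lemma mem_paired_enum a x : (x \in paired_enum a) = (x \in a).
Proof. by rewrite mem_filter mem_paired_order andbT. Qed.

Lemma paired_enum_uniq a : uniq (paired_enum a).
Proof. exact: filter_uniq paired_order_uniq. Qed.

Lemma size_paired_enum (a : {set 'I_12}) : size (paired_enum a) = #|a|.
Proof.
rewrite -(card_uniqP (paired_enum_uniq a)).
by apply: eq_card => x; rewrite mem_paired_enum.
Qed.

(** Partners are neighbours in [paired_order], and filtering preserves this when both belong to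
    [b]. *)
Lemma paired_enum_split b i : i \in full_pairs b ->
  exists s1 s2, paired_enum b = s1 ++ [:: i, rev_ord i & s2] /\
    paired_enum (b :\: ord_pair i) = s1 ++ s2.
Proof.
rewrite in_full => /and3P[i6 ib rib].
have [L1 [L2 LE]] : exists L1 L2, paired_order = L1 ++ [:: i, rev_ord i & L2].
  pose g j := [:: ord12 j; rev_ord (ord12 j)].
  exists (flatten (map g (iota 0 i))), (flatten (map g (iota i.+1 (6 - i.+1)))).
  rewrite /paired_order;
    have -> : iota 0 6 = iota 0 i ++ (i : nat) :: iota i.+1 (6 - i.+1).
    have E6 : 6 = (i + (6 - i.+1).+1)%N by lia.
    by rewrite [X in iota 0 X]E6 iotaD.
  by rewrite map_cat flatten_cat /= /ord12 inord_val.
have := paired_order_uniq; rewrite LE cat_uniq /= !negb_or.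
case/and3P=> _ /and3P[iL1 riL1 _] /and3P[/andP[_ iL2] riL2 _].
have filterD (s : seq 'I_12) : i \notin s -> rev_ord i \notin s ->
    [seq x <- s | x \in b :\: ord_pair i] = [seq x <- s | x \in b].
  move=> iS riS; apply: eq_in_filter => x xs; rewrite in_setD in_pair.
  case: eqVneq xs => [->|_]; first by rewrite (negPf iS).
  by case: eqVneq => [->|//]; rewrite (negPf riS).
exists [seq x <- L1 | x \in b], [seq x <- L2 | x \in b].
rewrite /paired_enum LE !filter_cat /= ib rib !in_setD !in_pair !eqxx orbT /=.
by rewrite !filterD.
Qed.

(** The default [ord0] is not reached when [a] has [k] elements. *)
Definition paired_ffun k (a : {set 'I_12}) : {ffun 'I_k -> 'I_12} :=
  [ffun j : 'I_k => nth ord0 (paired_enum a) j].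

Section PairedFfun.
Variables (k : nat) (a : {set 'I_12}).
Hypothesis ca : #|a| = k.

Lemma paired_ffun_inj : injective (paired_ffun k a).
Proof.
move=> i j; rewrite !ffunE => /eqP.
rewrite nth_uniq ?size_paired_enum ?ca ?paired_enum_uniq // => /eqP.
exact: val_inj.
Qed.

Lemma paired_ffun_mem j : paired_ffun k a j \in a.
Proof. by rewrite ffunE -mem_paired_enum mem_nth // size_paired_enum ca. Qed.

Lemma paired_ffun_index x : x \in a -> exists j, paired_ffun k a j = x.
Proof.
rewrite -mem_paired_enum => xa.
have xk : (index x (paired_enum a) < k)%N by rewrite -ca -size_paired_enum
  index_mem.
by exists (Ordinal xk); rewrite ffunE nth_index.
Qed.
End PairedFfun.

(** Plays the role of the family [t] in [wedge_basisP]; the next three lemmas are its hypotheses. *)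
Definition paired_index k (a : index_set k 12) := paired_ffun k (val a).

Lemma paired_index_inj k (a : index_set k 12) : injective (paired_index a).
Proof. exact/paired_ffun_inj/eqP/(valP a). Qed.

Lemma paired_index_neq k (a b : index_set k 12) : a != b ->
  exists i, forall j, paired_index b i != paired_index a j.
Proof.
have /eqP ca := valP a; have /eqP cb := valP b.
move=> ab; have /subsetPn[x xb xa] : ~~ (val b \subset val a).
  apply: contra ab => ba; rewrite eq_sym -val_eqE eqEcard ba.
  exact: (eq_leq (etrans ca (esym cb))).
have [i ix] := paired_ffun_index cb xb.
exists i => j; rewrite [paired_index b i]ix; apply: contraNneq xa => ->.
exact: paired_ffun_mem.
Qed.

Lemma paired_index_all k (phi : 'I_k -> 'I_12) : injective phi ->
  exists a : index_set k 12, exists s : 'S_k, forall i,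
    phi i = paired_index a (s i).
Proof.
move=> phi_inj.
have ca : #|phi @: 'I_k| == k by rewrite card_imset // card_ord.
have /fin_all_exists[s sP] i : exists j, paired_ffun k (phi @: 'I_k) j = phi i.
  by apply: paired_ffun_index; [apply/eqP | apply: imset_f].
have s_inj : injective s by move=> i j ij; apply: phi_inj; rewrite -!sP ij.
exists (Sub (phi @: 'I_k) ca : index_set k 12), (perm s_inj) => i.
by rewrite permE /paired_index /= sP.
Qed.

Section Contraction.
Variables (F : fieldType) (E : vectType F) (form : {biscalar E}).
Variables (W6 W4 : vectType F).
Variables (wedge6 : {ffun 'I_6 -> E} -> W6) (wedge4 : {ffun 'I_4 -> E} -> W4).
Variable f : 'Hom(W6, W4).
Hypothesis contr_f : contraction_map form wedge6 wedge4 f.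
Variable X : 12.-tuple E.
Hypothesis formX : forall i j : 'I_12, (i < 6)%N || (j != rev_ord i) ->
  form X`_i X`_j = (j == rev_ord i)%:R.

(** A term survives only if [s] and [t] are the positions of partners. These are adjacent with the
    member below 6 first, so form and sign are both 1. *)
Lemma contraction_paired (b : {set 'I_12}) : #|b| = 6%N ->
  f (wedge6 (basis_args X (paired_ffun 6 b))) =
  \sum_(i in full_pairs b) wedge4 (basis_args X (paired_ffun 4 (b :\: ord_pair
    i))).
Proof.
move=> cb; set T := paired_ffun 6 b.
have T_inj : injective T by exact: paired_ffun_inj.
(* If position [s] holds the lower member of a full pair, its partner comes next, and omitting both
   enumerates the remaining 4-set. *)
have position (s : 'I_6) : T s \in full_pairs b ->
    [/\ (s.+1 < 6)%N, T (inord s.+1) = rev_ord (T s)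
      & forall t : 'I_6, t = s.+1 :> nat ->
        omit2 (basis_args X T) s t = basis_args X (paired_ffun 4 (b :\:
          ord_pair (T s)))].
  move=> /[dup] Tb /paired_enum_split[s1 [s2 [bE bE']]].
  have sz : (size s1 + (size s2).+2 = 6)%N.
    by have := size_paired_enum b; rewrite bE size_cat cb.
  have s1_6 : (size s1 < 6)%N by lia.
  have sE : size s1 = s.
    have : T (Ordinal s1_6) = T s by rewrite ffunE bE nth_cat ltnn subnn.
    by move/T_inj => <-.
  have s6 : (s.+1 < 6)%N by rewrite -sE; lia.
  split=> // [|t tE].
    rewrite [LHS]ffunE inordK // bE nth_cat -sE ltnNge leqnSn /=.
    by rewrite subSnn.
  apply/ffunP => j; rewrite [LHS]ffunE [LHS]ffunE [RHS]ffunE.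
  congr X`_(nat_of_ord _); rewrite [LHS]ffunE [RHS]ffunE.
  have jl : (bump t (bump s j) < 6)%N by rewrite tE /bump; have := ltn_ord j; lia.
  rewrite inordK // bE bE' !nth_cat tE sE /bump.
  have [sj|js] := leqP s j.
    rewrite add1n ltnS sj add1n.
    have -> : (j.+2 < s)%N = false by lia.
    by have -> : (j.+2 - s = (j - s).+2)%N by lia.
  rewrite !add0n; have -> : (s < j)%N = false by lia.
  by rewrite add0n js.
rewrite contr_f.
have -> : full_pairs b = T @: [set s | T s \in full_pairs b].
  apply/setP => x; apply/idP/imsetP => [xb|[s + ->]]; last by rewrite in_set.
  have [|s sx] := paired_ffun_index cb (x := x).
    by move: xb; rewrite in_full => /and3P[].
  by exists s; rewrite // in_set [T s]sx.
rewrite big_imset => [|s s' _ _]; last exact: T_inj.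
rewrite [RHS]big_mkcond; apply: eq_bigr => s _ /=; rewrite inE.
have formT t : form (basis_args X T s) (basis_args X T t) = form X`_(T s) X`_(T
  t).
  by rewrite !ffunE.
case: ifP => [Tb|Tb].
  have [s6 Ts omitE] := position s Tb.
  have T6 : (T s < 6)%N by move: Tb; rewrite in_full => /andP[].
  rewrite (bigD1 (inord s.+1)) /=; last by rewrite inordK.
  rewrite big1 => [|t /andP[_ tne]].
    rewrite addr0 formT formX ?T6 // Ts eqxx mulr1 omitE ?inordK //.
    (* With [t = s + 1] the exponent is [2 s + 2]. *)
    by rewrite -signr_odd addnS /= oddD addbb scale1r.
  rewrite formT formX ?T6 // -Ts (inj_eq T_inj) (negPf tne) mulr0 scale0r //.
rewrite big1 // => t st; rewrite formT.
have Tmem r : T r \in b by exact: paired_ffun_mem.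
(* No partner follows position [s]: either the partner is not in [b], or [T s] is an upper member
   and its partner immediately precedes it. *)
have nrev : T t != rev_ord (T s).
  apply/eqP => Tt; have [T6|T6] := boolP (T s < 6)%N.
    by move: Tb; rewrite in_full T6 Tmem -Tt Tmem.
  have Ttb : T t \in full_pairs b by rewrite in_full Tt rev_ord_lt6 T6 -Tt Tmem
    Tt rev_ordK Tmem.
  have [t6 + _] := position t Ttb; rewrite Tt rev_ordK => /T_inj sE.
  by move: st; rewrite -sE inordK // ltnNge leqnSn.
by rewrite formX ?nrev ?orbT // (negPf nrev) mulr0 scale0r.
Qed.
End Contraction.

(** In the wedge bases from paired enumerations the matrix of [f] is the transpose of the Pluecker
    matrix; 924 is the number of 6-subsets of a 12-set. *)
Lemma dim_lker_contraction (F : fieldType) (E : vectType F) (form : {biscalar E})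
    (dimE : \dim {:E} = 12%N) (sympE : symplectic form)
    (W6 W4 : vectType F)
    (wedge6 : {ffun 'I_6 -> E} -> W6) (wedge4 : {ffun 'I_4 -> E} -> W4)
    (extW6 : exterior_power wedge6) (extW4 : exterior_power wedge4)
    (f : 'Hom(W6, W4)) (contr_f : contraction_map form wedge6 wedge4 f) :
  \dim {:W6} = 924%N /\ \dim (lker f) = (924 - \rank (plucker_matrix F))%N.
Proof.
have [X bX formX] := symplectic_basis_ex sympE dimE.
have b6 := wedge_basisP bX (@paired_index_inj 6) (@paired_index_neq 6)
  (@paired_index_all 6) extW6.
have b4 := wedge_basisP bX (@paired_index_inj 4) (@paired_index_neq 4)
  (@paired_index_all 4) extW4.
have c6 : #|index_set 6 12| = 924%N by rewrite card_index_set.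
split; first by rewrite (size_basis b6) c6.
rewrite (dim_lker_matrix (M := (plucker_matrix F)^T) b6 b4).
  by rewrite mxrank_tr; congr (_ - _)%N.
move=> c; rewrite nth_mktuple (contraction_paired contr_f formX (eqP (valP
  (enum_val c)))).
set b := val (enum_val c); have cb : #|b| = 6%N := eqP (valP (enum_val c)).
under [RHS]eq_bigr => r _ do
  rewrite !mxE (plucker_coefE F (eqP (valP (enum_val r))) cb) scaler_suml.
rewrite exchange_big; apply: eq_bigr => i ib /=.
have cbi : #|b :\: ord_pair i| == 4%N by rewrite (cardD_pair ib cb).
rewrite (bigD1 (enum_rank (Sub (b :\: ord_pair i) cbi : index_set 4 12))) //=.
rewrite enum_rankK /= eqxx scale1r wedge_basisE big1 ?addr0 // => r rne.
case: eqP => [rE|_]; last by rewrite scale0r.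
by case/eqP: rne; apply: enum_val_inj; rewrite enum_rankK; apply: val_inj.
Qed.

(** The codimension of P(ker f) equals the rank of [f], hence rank B. The numbers 429, 494 and 430
    that the English statement gives as codimensions appear here as the vector space dimensions of
    ker f. *)
Theorem mainTheorem2 (F : fieldType) (E : vectType F) (form : {biscalar E})
    (dimE : \dim {:E} = 12%N) (sympE : symplectic form)
    (W6 W4 : vectType F)
    (wedge6 : {ffun 'I_6 -> E} -> W6) (wedge4 : {ffun 'I_4 -> E} -> W4)
    (extW6 : exterior_power wedge6) (extW4 : exterior_power wedge4)
    (f : 'Hom(W6, W4)) (contr_f : contraction_map form wedge6 wedge4 f) :
  [/\ [pchar F] =i pred0 ->
        [/\ \rank (plucker_matrix F) = 495%N, \dim (lker f) = 429%N
          & proj_codim (lker f) = 495%N],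
      2%N \in [pchar F] ->
        [/\ \rank (plucker_matrix F) = 430%N, \dim (lker f) = 494%N
          & proj_codim (lker f) = 430%N],
      3%N \in [pchar F] ->
        [/\ \rank (plucker_matrix F) = 494%N, \dim (lker f) = 430%N
          & proj_codim (lker f) = 494%N]
    & forall p : nat, (5 <= p)%N -> p \in [pchar F] ->
        [/\ \rank (plucker_matrix F) = 495%N, \dim (lker f) = 429%N
          & proj_codim (lker f) = 495%N]].
Proof.
have [dimW6 dimK] := dim_lker_contraction dimE sympE extW6 extW4 contr_f.
have finish r : \rank (plucker_matrix F) = r -> (r <= 924)%N ->
    [/\ \rank (plucker_matrix F) = r, \dim (lker f) = (924 - r)%N
      & proj_codim (lker f) = r].
  by move=> rk r924; rewrite /proj_codim dimW6 dimK rk subKn.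
split=> [ch0|ch2|ch3|p p5 chp].
- apply: finish => //; apply: plucker_rank_generic.
    by have := ch0 2%N; rewrite !inE /= => ->.
  by have := ch0 3%N; rewrite !inE /= => ->.
- by apply: finish => //; apply: plucker_rank2.
- by apply: finish => //; apply: plucker_rank3.
- have pE := dvdn_pcharf chp.
  by apply: finish => //; apply: plucker_rank_generic; rewrite -pE gtnNdvd // (leq_trans _ p5).
Qed.
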